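(* Let $s:\mathbb{N}\to\mathbb{N}$. Suppose there are $\alpha>0$ and $c>0$, an infinite set $S\subseteq\mathbb{N}$, and for each $n\in S$ an integer $r_n\ge1$, such that $r_n/(n\,s(n))^{2/\alpha}\to\infty$ as $n\to\infty$ in $S$ and, for every $n\in S$, the sign-rank-$r_n$ rigidity of $H_n$ is at least $c\cdot 4^n/r_n^{1-\alpha}$. Then the Inner Product Modulo 2 does not have $\mathsf{LTF}\circ\mathsf{LTF}$ circuits of $s(n)$ gates; that is, for infinitely many $n$, $IP2_n$ has no $\mathsf{LTF}\circ\mathsf{LTF}$ circuit with at most $s(n)$ gates.
   Context: $H_n$ is the $2^n\times2^n$ real matrix indexed by $\{0,1\}^n\times\{0,1\}^n$ with $H_n(u,v)=(-1)^{\langle u,v\rangle}$, $\langle u,v\rangle=\sum_ku_kv_k$. $IP2_n:\{0,1\}^n\times\{0,1\}^n\to\{0,1\}$ is $IP2_n(x,y)=\sum_k x_ky_k \bmod 2$. The sign-rank of a real matrix $A$ is the minimum rank of a real matrix $B$ with $\mathrm{sign}(B_{ij})=\mathrm{sign}(A_{ij})$ for all $i,j$. The sign-rank-$r$ rigidity of $A$ is the minimum number of entries of $A$ that must be changed (to arbitrary reals) so that the resulting matrix has sign-rank at most $r$. A linear threshold gate ($\mathsf{LTF}$) computes $z\mapsto[\sum_iw_iz_i\ge\theta]$ with real weights; an $\mathsf{LTF}\circ\mathsf{LTF}$ circuit with $s$ gates consists of LTF gates on the input bits whose outputs feed a single output LTF gate. *)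

(* Defs.v *)
From HB Require Import structures.
From mathcomp Require Import all_boot all_order all_algebra.
From mathcomp Require Import all_classical all_reals all_analysis.

Set Implicit Arguments.
Unset Strict Implicit.
Unset Printing Implicit Defensive.

Import Order.TTheory GRing.Theory Num.Theory.
Local Open Scope ring_scope.

Definition inner n (x y : n.-tuple bool) : nat :=
  (\sum_(k < n) tnth x k * tnth y k)%N.

(* Rows and columns are the elements of {0,1}^n, in the order of [enum]. *)
Definition hadamard (R : realType) n : 'M[R]_#|{: n.-tuple bool}| :=
  \matrix_(i, j) (-1) ^+ inner (enum_val i) (enum_val j).

Definition IP2 n (x y : n.-tuple bool) : bool := odd (inner x y).

(* [Num.sg] takes values in {-1, 0, 1}, so zero entries must stay zero. *)
Definition same_sign (R : realType) m n (A B : 'M[R]_(m, n)) : Prop :=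
  forall i j, Num.sg (B i j) = Num.sg (A i j).

Lemma sign_rank_ex (R : realType) m n (A : 'M[R]_(m, n)) :
  exists k, `[< exists2 B : 'M[R]_(m, n), same_sign A B & \rank B = k >].
Proof. by exists (\rank A); apply/asboolP; exists A. Qed.

Definition sign_rank (R : realType) m n (A : 'M[R]_(m, n)) : nat :=
  ex_minn (sign_rank_ex A).

Definition num_changes (R : realType) m n (A B : 'M[R]_(m, n)) : nat :=
  #|[set p : 'I_m * 'I_n | B p.1 p.2 != A p.1 p.2]|.

Lemma sign_rigidity_ex (R : realType) m n (A : 'M[R]_(m, n)) (r : nat) :
  exists k, `[< exists2 B : 'M[R]_(m, n),
    (sign_rank B <= r)%N & num_changes A B = k >].
Proof.
exists (num_changes A 0); apply/asboolP; exists 0 => //.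
rewrite /sign_rank; case: ex_minnP => k _ /(_ 0%N) k_min.
by rewrite (leq_trans (k_min _)) //; apply/asboolP; exists 0; rewrite ?mxrank0.
Qed.

Definition sign_rigidity (R : realType) m n (A : 'M[R]_(m, n)) (r : nat) :
    nat :=
  ex_minn (sign_rigidity_ex A r).

Record ltf (R : realType) (m : nat) := Ltf {
  ltf_weight : 'I_m -> R;
  ltf_threshold : R
}.

Definition ltf_eval (R : realType) m (g : ltf R m) (z : m.-tuple bool) : bool :=
  ltf_threshold g <= \sum_(i < m) ltf_weight g i * (tnth z i)%:R.

Record ltf_ltf_circuit (R : realType) (m : nat) := LtfLtfCircuit {
  num_bottom : nat;
  bottom_gate : 'I_num_bottom -> ltf R m;
  top_gate : ltf R num_bottom
}.

(* The output gate is counted. *)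
Definition num_gates (R : realType) m (C : ltf_ltf_circuit R m) : nat :=
  (num_bottom C).+1.

Definition circuit_eval (R : realType) m (C : ltf_ltf_circuit R m)
    (z : m.-tuple bool) : bool :=
  ltf_eval (top_gate C) [tuple ltf_eval (bottom_gate i) z | i < num_bottom C].

(* The input bits of a circuit for IP2 are those of x followed by those of y. *)
Definition computes_IP2 (R : realType) n (C : ltf_ltf_circuit R (n + n)) :
    Prop :=
  forall x y : n.-tuple bool, circuit_eval C [tuple of x ++ y] = IP2 x y.

(* Main.v *)
(** With [N = 2^n], the matrix [(x, y) |-> g (x, y)] of a threshold gate is a
    staircase matrix: its rows are nested.  Merging rows of nearly equal weight
    makes its rank at most [t] after at most [N^2 / t] changes.  Hence a circuit
    with [m] bottom gates yields, off [m N^2 / t] entries, a sign representation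
    of [H_n] of rank at most [m t + 1]: its rigidity at rank [r] is
    [O(s^2 N^2 / r)].
    Against the assumed bound [c N^2 r^alpha / r] this gives
    [c r^alpha <= 2 s^2], which fails as soon as [r / s^(2 / alpha)] is large.
    The trivial bound [N^2] on the rigidity gives [c r^alpha <= r], so that
    [r > 2 s^2] and the choice [t = (r - 1) / s] is positive, whatever
    [alpha] is. *)
Require Import Defs.
From HB Require Import structures.
From mathcomp Require Import all_boot all_order all_algebra.
From mathcomp Require Import all_classical all_reals all_analysis.
From mathcomp Require Import zify lra.

Set Implicit Arguments.
Unset Strict Implicit.
Unset Printing Implicit Defensive.

Import Order.TTheory GRing.Theory Num.Theory.
Local Open Scope classical_set_scope.
Local Open Scope ring_scope.

Lemma sign_rank_le (R : realType) m n (A B : 'M[R]_(m, n)) :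
  same_sign A B -> (sign_rank A <= \rank B)%N.
Proof.
move=> AB; rewrite /sign_rank; case: ex_minnP => k _; apply.
by apply/asboolP; exists B.
Qed.

Lemma sign_rigidity_le (R : realType) m n (A B : 'M[R]_(m, n)) r :
  (sign_rank B <= r)%N -> (sign_rigidity A r <= num_changes A B)%N.
Proof.
move=> Br; rewrite /sign_rigidity; case: ex_minnP => k _; apply.
by apply/asboolP; exists B.
Qed.

Lemma sign_rigidity_le_size (R : realType) m n (A : 'M[R]_(m, n)) r :
  (sign_rigidity A r <= m * n)%N.
Proof.
have r0 : (sign_rank (0 : 'M[R]_(m, n)) <= r)%N.
  by rewrite (leq_trans (@sign_rank_le _ _ _ 0 0 _)) ?mxrank0.
rewrite (leq_trans (sign_rigidity_le A r0)) // (leq_trans (max_card _)) //.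
by rewrite card_prod !card_ord.
Qed.

Lemma card_setD_chain (T : finType) (A B : {set T}) :
  (A \subset B) || (B \subset A) ->
  #|(A :\: B) :|: (B :\: A)| = ((#|A| - #|B|) + (#|B| - #|A|))%N.
Proof.
wlog AB : A B / A \subset B => [hw /orP[]AB|_].
- by apply: hw; rewrite AB.
- by rewrite finset.setUC addnC; apply: hw; rewrite AB.
have /eqP -> : A :\: B == finset.set0 by rewrite finset.setD_eq0.
rewrite finset.set0U cardsD (finset.setIidPr AB).
by have /eqP -> : (#|A| - #|B| == 0)%N by rewrite subn_eq0 subset_leq_card.
Qed.

(* Rows are grouped by the quotient of their cardinality by [n %/ t + 1]: there
   are at most [t] groups, and two rows of a group, being nested, differ in at
   most [n %/ t] entries, so each row is replaced by one representative. *)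
Lemma nested_rows_approx (F : fieldType) m n t (M : 'I_m -> {set 'I_n}) :
  (0 < t)%N ->
  (forall i i', (M i \subset M i') || (M i' \subset M i)) ->
  exists2 A : 'M[F]_(m, n), (\rank A <= t)%N &
    (#|[set p : 'I_m * 'I_n | A p.1 p.2 != (p.2 \in M p.1)%:R]%SET| * t
       <= m * n)%N.
Proof.
case: t => // t _ chain; pose k := (n %/ t.+1).+1.
have qlt i : (#|M i| %/ k < t.+1)%N.
  rewrite ltn_divLR // (leq_ltn_trans (max_card _)) // card_ord mulnC.
  by rewrite /k ltn_ceil.
pose q i : 'I_t.+1 := Ordinal (qlt i).
pose rep i := odflt i [pick i' | q i' == q i].
have repq i : q (rep i) = q i.
  by rewrite /rep; case: pickP => [i' /eqP|].
have repE i i' : q i = q i' -> rep i = rep i'.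
  rewrite /rep => ->; case: pickP => // /(_ i').
  by rewrite eqxx.
pose P : 'M[F]_(m, t.+1) := \matrix_(i, a) (q i == a)%:R.
pose Q : 'M[F]_(t.+1, n) := \matrix_(a, j)
  (if [pick i | q i == a] is Some i then (j \in M (rep i))%:R else 0).
have PQE i j : (P *m Q) i j = (j \in M (rep i))%:R.
  rewrite mxE (bigD1 (q i)) //= big1 ?addr0 => [|a /negPf aq]; last first.
    by rewrite mxE eq_sym aq mul0r.
  rewrite !mxE eqxx mul1r; case: pickP => [i' /eqP /repE -> //|/(_ i)].
  by rewrite eqxx.
exists (P *m Q); first by rewrite (leq_trans (mxrankM_maxr _ _)) ?rank_leq_row.
pose D i := ((M i :\: M (rep i)) :|: (M (rep i) :\: M i))%SET.
have Dle i : (#|D i| <= n %/ t.+1)%N.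
  rewrite /D card_setD_chain //; have /(congr1 val)/= := repq i.
  have := divn_eq #|M i| k; have := divn_eq #|M (rep i)| k.
  have := ltn_pmod #|M i| (ltn0Sn (n %/ t.+1)).
  have := ltn_pmod #|M (rep i)| (ltn0Sn (n %/ t.+1)).
  rewrite -/k; move: (_ %/ k)%N (_ %/ k)%N => a b.
  move: (_ %% k)%N (_ %% k)%N => u v u_lt v_lt -> -> ->.
  by rewrite !subnDl; move: u_lt v_lt; rewrite /k; lia.
have -> : #|[set p : 'I_m * 'I_n |
    (P *m Q) p.1 p.2 != (p.2 \in M p.1)%:R]%SET| = (\sum_(i < m) #|D i|)%N.
  rewrite -sum1_card (eq_bigl (fun p : 'I_m * 'I_n => true && (p.2 \in D p.1))).
    rewrite -(pair_big_dep xpredT (fun i j => j \in D i) (fun _ _ => 1%N)) /=.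
    by apply: eq_bigr => i _; rewrite sum1_card.
  move=> [i j]; rewrite !inE /= PQE.
  by do 2![case: (j \in _)]; rewrite /= ?eqxx ?oner_eq0 // eq_sym oner_eq0.
apply: (@leq_trans ((\sum_(i < m) n %/ t.+1) * t.+1)%N).
  by rewrite leq_mul2r leq_sum ?orbT // => i _; exact: Dle.
by rewrite sum_nat_const card_ord -mulnA leq_mul2l leq_divM orbT.
Qed.

Lemma ltf_eval_cat (R : realType) m n (g : ltf R (m + n)) :
  exists (a : m.-tuple bool -> R) (b : n.-tuple bool -> R),
  forall (x : m.-tuple bool) (y : n.-tuple bool),
    ltf_eval g [tuple of x ++ y] = (ltf_threshold g <= a x + b y).
Proof.
exists (fun x : m.-tuple bool =>
  \sum_(i < m) ltf_weight g (lshift n i) * (tnth x i)%:R).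
exists (fun y : n.-tuple bool =>
  \sum_(i < n) ltf_weight g (rshift m i) * (tnth y i)%:R).
move=> x y; rewrite /ltf_eval big_split_ord /=.
by congr (_ <= _ + _); apply: eq_bigr => i _; rewrite ?tnth_lshift ?tnth_rshift.
Qed.

Definition ltf_entry (R : realType) m n (g : ltf R (m + n))
    (p : 'I_#|{: m.-tuple bool}| * 'I_#|{: n.-tuple bool}|) : bool :=
  let x : m.-tuple bool := enum_val p.1 in
  let y : n.-tuple bool := enum_val p.2 in
  ltf_eval g [tuple of x ++ y].

Lemma ltf_matrix_approx (R : realType) m n t (g : ltf R (m + n)) :
  (0 < t)%N ->
  exists A : 'M[R]_(#|{: m.-tuple bool}|, #|{: n.-tuple bool}|),
    (\rank A <= t)%N /\
    (#|[set p | A p.1 p.2 != (ltf_entry g p)%:R]%SET| * t <= 2 ^ m * 2 ^ n)%N.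
Proof.
move=> t0; have [a [b gE]] := ltf_eval_cat g.
pose M i := [set j | ltf_entry g (i, j)]%SET.
have chain i i' : (M i \subset M i') || (M i' \subset M i).
  have [aa|/ltW aa] := leP (a (enum_val i)) (a (enum_val i')); apply/orP;
    [left|right]; apply/fintype.subsetP => j;
    rewrite !inE /ltf_entry !gE => /le_trans; apply; by rewrite lerD2r.
have [A rA eA] := nested_rows_approx R t0 chain.
exists A; split=> //; have -> : (2 ^ m * 2 ^ n =
    #|{: m.-tuple bool}| * #|{: n.-tuple bool}|)%N.
  by rewrite !card_tuple card_bool.
apply: leq_trans eA; rewrite leq_mul2r; apply/orP; right.
by apply/subset_leq_card/fintype.subsetP => -[i j]; rewrite !inE.
Qed.

Lemma threshold_sg (R : realFieldType) (T : finType) (v : T -> R) (theta : R) :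
  exists theta', forall z, Num.sg (theta' - v z) = (-1) ^+ (theta <= v z)%R.
Proof.
pose M := \big[Order.max/theta - 1]_(z | v z < theta) v z.
have Mlt : M < theta by apply/bigmax_ltP; split => //; rewrite ltrBlDr ltrDl.
exists ((M + theta) / 2) => z; have [le|lt] := leP theta (v z).
  by rewrite ltr0_sg // subr_lt0 (lt_le_trans _ le) //; lra.
have zM : v z <= M by exact: le_bigmax_cond.
by rewrite gtr0_sg // subr_gt0; lra.
Qed.

Lemma rank_sum_scale (F : fieldType) m n k t (w : 'I_k -> F)
    (A : 'I_k -> 'M[F]_(m, n)) :
  (forall i, \rank (A i) <= t)%N -> (\rank (\sum_i w i *: A i)%R <= k * t)%N.
Proof.
move=> rA; rewrite -[k in leqRHS]card_ord -sum_nat_const.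
elim/big_ind2: _ => [|B b D d leB leD|i _]; first by rewrite mxrank0.
  by rewrite (leq_trans (mxrank_add _ _)) // leq_add.
by rewrite (leq_trans (mxrank_scale _ _)).
Qed.

Lemma circuit_sign_rigidity (R : realType) n (C : ltf_ltf_circuit R (n + n))
    t r :
  computes_IP2 C -> (0 < t)%N -> (num_bottom C * t < r)%N ->
  (sign_rigidity (hadamard R n) r * t <= num_bottom C * 4 ^ n)%N.
Proof.
move=> CIP t0 tr; set N := #|{: n.-tuple bool}|.
have [A AP] := choice (fun k : 'I_(num_bottom C) =>
  ltf_matrix_approx (bottom_gate k) t0).
pose bad k := [set p | A k p.1 p.2 != (ltf_entry (bottom_gate k) p)%:R]%SET.
pose w := ltf_weight (top_gate C).
pose v (p : 'I_N * 'I_N) := \sum_i w i * (ltf_entry (bottom_gate i) p)%:R.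
have [th thP] := threshold_sg v (ltf_threshold (top_gate C)).
pose G : 'M[R]_N := const_mx th - \sum_i w i *: A i.
pose B : 'M[R]_N := \matrix_(i, j)
  if (i, j) \in (\bigcup_k bad k)%SET then G i j else hadamard R n i j.
have sgG i j : (i, j) \notin (\bigcup_k bad k)%SET ->
    Num.sg (G i j) = hadamard R n i j.
  move=> ok; rewrite !mxE summxE.
  have -> : \sum_k (w k *: A k) i j = v (i, j).
    apply: eq_bigr => k _; rewrite mxE; congr (_ * _); apply/eqP.
    by apply: contraNT ok => bk; apply/bigcupP; exists k; rewrite ?inE.
  rewrite thP -[RHS]signr_odd -[odd (inner _ _)]/(IP2 _ _) -CIP.
  congr (_ ^+ nat_of_bool (_ <= _)).
  by apply: eq_bigr => k _; rewrite tnth_mktuple.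
have BG : same_sign B G.
  move=> i j; rewrite [B i j]mxE; case: ifPn => // ok.
  rewrite sgG // !mxE -signr_odd.
  by case: odd; rewrite ?expr0 ?expr1 ?sgrN sgr1.
have rG : (\rank G <= r)%N.
  rewrite (leq_trans (mxrank_add _ _)) // mxrank_opp.
  apply: leq_trans tr; rewrite -addn1 addnC leq_add //.
    by apply: rank_sum_scale => k; case: (AP k).
  have -> : const_mx th = (const_mx th : 'cV_N) *m (const_mx 1 : 'rV_N).
    by apply/matrixP => i j; rewrite !mxE big_ord1 !mxE mulr1.
  by rewrite (leq_trans (mxrankM_maxl _ _)) ?rank_leq_col.
have BH : (num_changes (hadamard R n) B <= \sum_k #|bad k|)%N.
  apply: leq_trans (_ : #|(\bigcup_k bad k)%SET| <= _)%N.
    apply/subset_leq_card/fintype.subsetP => -[i j].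
    by rewrite inE /= [B i j]mxE; case: ifP; rewrite ?eqxx.
  elim/big_ind2: _ => [|x X y Y lex ley|//]; first by rewrite cards0.
  by rewrite (leq_trans (leq_card_setU _ _)) // leq_add.
have HB := sign_rigidity_le (hadamard R n) (leq_trans (sign_rank_le BG) rG).
apply: (@leq_trans ((\sum_k #|bad k|) * t)%N).
  by rewrite leq_mul2r (leq_trans HB BH) orbT.
rewrite big_distrl /= -[X in (_ <= X * _)%N]card_ord -sum_nat_const leq_sum //.
by move=> k _; rewrite -[4%N]/(2 * 2)%N expnMn; case: (AP k).
Qed.

Theorem theoremD3 (R : realType) (s : nat -> nat) (alpha c : R)
    (S : set nat) (r : nat -> nat) :
  0 < alpha -> 0 < c -> infinite_set S ->
  (forall n, S n -> (1 <= r n)%N) ->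
  (r n)%:R / (n * s n)%:R `^ (2 / alpha) @[n --> within S \oo] --> +oo ->
  (forall n, S n ->
    c * 4 ^+ n / (r n)%:R `^ (1 - alpha)
      <= (sign_rigidity (hadamard R n) (r n))%:R) ->
  infinite_set [set n : nat |
    ~ exists C : ltf_ltf_circuit R (n + n),
        (num_gates C <= s n)%N /\ computes_IP2 C].
Proof.
move=> a0 c0 Sinf r1 lim rig fin.
pose K : R := (3 / c) `^ alpha^-1.
have : \forall n \near within S \oo,
    K <= (r n)%:R / (n * s n)%:R `^ (2 / alpha).
  by move/cvgryPge : lim; exact.
move=> [n0 _ n0P].
have [n [Sn n_gt0 nn0 [C [Cs CIP]]]] : exists n, [/\ S n, (0 < n)%N, (n0 <= n)%N
    & exists C : ltf_ltf_circuit R (n + n),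
        (num_gates C <= s n)%N /\ computes_IP2 C].
  apply: contrapT => noC; apply: Sinf.
  have := conj fin (finite_II (maxn n0 1)).
  rewrite -finite_setU; apply: sub_finite_set.
  move=> n Sn; have [nlt|nge] := ltnP n (maxn n0 1); [by right|left=> CP].
  by apply: noC; exists n; move: nge; rewrite geq_max => /andP[? ?].
have s_gt0 : (0 < s n)%N by rewrite (leq_trans _ Cs).
have ns_gt0 : 0 < (n * s n)%:R :> R by rewrite ltr0n muln_gt0 n_gt0.
have r_gt0 : 0 < (r n)%:R :> R by rewrite ltr0n r1.
have c3 : 0 < 3 / c by rewrite divr_gt0.
pose ra := (r n)%:R `^ alpha.
have ra_big : 2 * (s n)%:R ^+ 2 < c * ra.
  have := n0P n nn0 Sn; rewrite ler_pdivlMr ?powR_gt0 // => Kle.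
  have : (K * (n * s n)%:R `^ (2 / alpha)) `^ alpha <= ra.
    by rewrite ge0_ler_powR ?nnegrE ?mulr_ge0 ?powR_ge0 // ltW.
  rewrite powRM ?powR_ge0 // -!powRrM mulVf ?gt_eqF // divfK ?gt_eqF //.
  rewrite powRr1 ?(ltW c3) // powR_mulrn ?(ltW ns_gt0) // mulrAC.
  rewrite ler_pdivrMr // [ra * c]mulrC; apply: lt_le_trans.
  rewrite natrM exprMn mulrA ltr_pM2r ?exprn_gt0 ?ltr0n //.
  have : 1 <= (n%:R : R) ^+ 2 by rewrite exprn_ege1 // ler1n.
  lra.
have rigE : c * 4 ^+ n * ra <=
    (sign_rigidity (hadamard R n) (r n))%:R * (r n)%:R.
  rewrite -ler_pdivrMr // (le_trans _ (rig n Sn)) //.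
  rewrite powRB; last by rewrite (gt_eqF r_gt0) implybT.
  by rewrite powRr1 ?(ltW r_gt0) // invf_div mulrA.
have four_gt0 : 0 < 4 ^+ n :> R by rewrite exprn_gt0.
have ra_le : c * ra <= (r n)%:R.
  rewrite -(ler_pM2l four_gt0) mulrCA mulrA (le_trans rigE) //.
  rewrite ler_pM2r // -natrX ler_nat (leq_trans (sign_rigidity_le_size _ _)) //.
  by rewrite card_tuple card_bool -expnMn.
have r_big : (2 * s n ^ 2 < r n)%N.
  by rewrite -(ltr_nat R) natrM natrX (lt_le_trans ra_big).
pose t := ((r n).-1 %/ s n)%N.
have ts : (r n <= 2 * s n * t)%N.
  have := divn_eq (r n).-1 (s n); rewrite -/t.
  have := ltn_pmod (r n).-1 s_gt0; move: r_big s_gt0; nia.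
have t_gt0 : (0 < t)%N.
  by move: (r1 _ Sn) ts; case: (t) => //; rewrite muln0; lia.
have tr : (num_bottom C * t < r n)%N.
  have := leq_divM (r n).-1 (s n); rewrite -/t.
  move: (r1 _ Sn) Cs; rewrite /num_gates; nia.
have := circuit_sign_rigidity CIP t_gt0 tr.
rewrite -(ler_nat R) !natrM natrX => err.
have tR : 0 < t%:R :> R by rewrite ltr0n.
have mr : (num_bottom C)%:R * (r n)%:R <= 2 * (s n)%:R ^+ 2 * t%:R :> R.
  rewrite -natrX -!natrM ler_nat; move: ts Cs; rewrite /num_gates; nia.
have : c * ra <= 2 * (s n)%:R ^+ 2.
  rewrite -(ler_pM2l four_gt0) -(ler_pM2r tR) mulrCA mulrA.
  apply: le_trans (ler_wpM2r (ltW tR) rigE) _.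
  rewrite mulrAC (le_trans (ler_wpM2r (ltW r_gt0) err)) //.
  by rewrite mulrAC [leLHS]mulrC -[leRHS]mulrA ler_pM2l.
by rewrite leNgt ra_big.
Qed.
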